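(* For a ring $R$ consider: (1) $R$ is left coherent. (2) Whenever a monomorphism $f: A\to E$ of left $R$-modules is an absolutely pure preenvelope of $A$, the epimorphism $f^+: E^+\to A^+$ is a flat precover of $A^+$ in $\mathrm{Mod}\,R^{op}$. (3) Whenever a monomorphism $f: A\to E$ of left $R$-modules is an injective preenvelope of $A$, the epimorphism $f^+: E^+\to A^+$ is a flat precover of $A^+$ in $\mathrm{Mod}\,R^{op}$. Then $(1)\Leftrightarrow(2)$ and $(1)\Rightarrow(3)$.
   Context: $(-)^+=\mathrm{Hom}_{\mathbb{Z}}(-,\mathbb{Q}/\mathbb{Z})$. A left module is absolutely pure (FP-injective) if it is a pure submodule of every module containing it. An absolutely pure (resp. injective) preenvelope of $A$ is a homomorphism $A\to E$ with $E$ absolutely pure (resp. injective) through which every homomorphism from $A$ to an absolutely pure (resp. injective) module factors. A flat precover of $M$ is a homomorphism $F\to M$ with $F$ flat through which every homomorphism from a flat module to $M$ factors. *)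

(* Defs.v *)
From HB Require Import structures.
From Stdlib Require Import Classical ClassicalEpsilon FunctionalExtensionality ProofIrrelevance.
From mathcomp Require Import all_boot all_order all_algebra.
Set Implicit Arguments. Unset Strict Implicit. Unset Printing Implicit Defensive.
Import Order.TTheory GRing.Theory Num.Theory.
Local Open Scope ring_scope.

(* Q/Z, realised as the fractional parts {x : rat | 0 <= x < 1}.        *)
Definition frac (x : rat) : rat := x - (Num.floor x)%:~R.

Lemma frac_shift (x : rat) (z : int) : frac (x + z%:~R) = frac x.
Proof.
rewrite /frac floorDrz ?intr_int // intrKfloor rmorphD /=.
by rewrite opprD addrACA subrr addr0.
Qed.

Lemma fracDl x y : frac (frac x + y) = frac (x + y).
Proof.
rewrite /frac -/(frac _).
have -> : x - (Num.floor x)%:~R + y = (x + y) + (- Num.floor x)%:~R.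
  by rewrite rmorphN /= addrAC.
by rewrite -/(frac (x + y + _)) frac_shift.
Qed.

Lemma fracDr x y : frac (x + frac y) = frac (x + y).
Proof. by rewrite addrC fracDl addrC. Qed.

Lemma fracK x : frac (frac x) = frac x.
Proof. by have := fracDl x 0; rewrite !addr0. Qed.

Lemma frac0 : frac 0 = 0.
Proof. by rewrite /frac floor0 subr0. Qed.

Definition QZ := {x : rat | frac x == x}.

Definition qz_of (x : rat) : QZ := exist _ (frac x) (introT eqP (fracK x)).
Definition qz0 : QZ := exist _ 0 (introT eqP frac0).
Definition qzadd (a b : QZ) : QZ := qz_of (sval a + sval b).
Definition qzopp (a : QZ) : QZ := qz_of (- sval a).

Lemma qz_eq (a b : QZ) : sval a = sval b -> a = b.
Proof.
case: a b => [a Ha] [b Hb] /= E; subst b; congr exist; exact: bool_irrelevance.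
Qed.

Lemma qz_val (a : QZ) : frac (sval a) = sval a.
Proof. by case: a => a /= /eqP. Qed.

Lemma qzaddA : associative qzadd.
Proof.
move=> a b c; apply: qz_eq => /=.
by rewrite fracDr fracDl addrA.
Qed.

Lemma qzaddC : commutative qzadd.
Proof. by move=> a b; apply: qz_eq => /=; rewrite addrC. Qed.

Lemma qzadd0 : left_id qz0 qzadd.
Proof. by move=> a; apply: qz_eq => /=; rewrite add0r qz_val. Qed.

Lemma qzaddN : left_inverse qz0 qzopp qzadd.
Proof. by move=> a; apply: qz_eq => /=; rewrite fracDl addNr frac0. Qed.

HB.instance Definition _ := [Choice of QZ by <:].
HB.instance Definition _ := GRing.isZmodule.Build QZ qzaddA qzaddC qzadd0 qzaddN.

Record lmod (R : nzRingType) := LMod {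
  lcar :> Type;
  lzero : lcar;
  ladd : lcar -> lcar -> lcar;
  lopp : lcar -> lcar;
  lscale : R -> lcar -> lcar;
  laddA : forall x y z, ladd x (ladd y z) = ladd (ladd x y) z;
  laddC : forall x y, ladd x y = ladd y x;
  ladd0 : forall x, ladd lzero x = x;
  laddN : forall x, ladd (lopp x) x = lzero;
  lscaleA : forall r s x, lscale r (lscale s x) = lscale (r * s) x;
  lscale1 : forall x, lscale 1 x = x;
  lscaleDr : forall r x y, lscale r (ladd x y) = ladd (lscale r x) (lscale r y);
  lscaleDl : forall r s x, lscale (r + s) x = ladd (lscale r x) (lscale s x)
}.

Record rmod (R : nzRingType) := RMod {
  rcar :> Type;
  rzero : rcar;
  radd : rcar -> rcar -> rcar;
  ropp : rcar -> rcar;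
  rscale : rcar -> R -> rcar;
  raddA : forall x y z, radd x (radd y z) = radd (radd x y) z;
  raddC : forall x y, radd x y = radd y x;
  radd0 : forall x, radd rzero x = x;
  raddN : forall x, radd (ropp x) x = rzero;
  rscaleA : forall x r s, rscale (rscale x r) s = rscale x (r * s);
  rscale1 : forall x, rscale x 1 = x;
  rscaleDl : forall x y r, rscale (radd x y) r = radd (rscale x r) (rscale y r);
  rscaleDr : forall x r s, rscale x (r + s) = radd (rscale x r) (rscale x s)
}.

Section Modules.
Variable R : nzRingType.

Definition lhom (M N : lmod R) (f : M -> N) : Prop :=
  (forall x y, f (ladd x y) = ladd (f x) (f y)) /\
  (forall r x, f (lscale r x) = lscale r (f x)).

Definition rhom (M N : rmod R) (f : M -> N) : Prop :=
  (forall x y, f (radd x y) = radd (f x) (f y)) /\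
  (forall x r, f (rscale x r) = rscale (f x) r).

(* X (x)_R M = (free abelian group on X * M) / (bilinearity, balancedness). *)
Definition fsum (X : rmod R) (M : lmod R) := X -> M -> int.

Definition delta (X : rmod R) (M : lmod R) (x : X) (m : M) : fsum X M :=
  fun x' m' => if excluded_middle_informative (x' = x /\ m' = m) then 1 else 0.

Inductive tensor_rel (X : rmod R) (M : lmod R) : fsum X M -> Prop :=
  | trel0 : tensor_rel (fun _ _ => 0)
  | treladd f g : tensor_rel f -> tensor_rel g ->
      tensor_rel (fun x m => f x m + g x m)
  | trelopp f : tensor_rel f -> tensor_rel (fun x m => - f x m)
  | trelL x x' m : tensor_rel (fun a b =>
      delta (radd x x') m a b - delta x m a b - delta x' m a b)
  | trelR x m m' : tensor_rel (fun a b =>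
      delta x (ladd m m') a b - delta x m a b - delta x m' a b)
  | trelS x r m : tensor_rel (fun a b =>
      delta (rscale x r) m a b - delta x (lscale r m) a b).

(* the element sum_i x_i (x) m_i of X (x)_R M, given s = [:: (x_i, m_i)] *)
Definition fsum_of (X : rmod R) (M : lmod R) (s : seq (X * M)) : fsum X M :=
  fun a b => \sum_(p <- s) delta p.1 p.2 a b.

Definition tensor_zero (X : rmod R) (M : lmod R) (s : seq (X * M)) : Prop :=
  tensor_rel (fsum_of s).

(* 1_X (x) f : X (x) A -> X (x) B is injective *)
Definition tensor_inj (X : rmod R) (A B : lmod R) (f : A -> B) : Prop :=
  forall s : seq (X * A),
    tensor_zero [seq (p.1, f p.2) | p <- s] -> tensor_zero s.

Definition pure_mono (A B : lmod R) (f : A -> B) : Prop :=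
  [/\ lhom f, injective f & forall X : rmod R, tensor_inj X f].

Definition abs_pure (A : lmod R) : Prop :=
  forall (B : lmod R) (f : A -> B), lhom f -> injective f -> pure_mono f.

Definition injective_mod (E : lmod R) : Prop :=
  forall (A B : lmod R) (i : A -> B) (g : A -> E),
    lhom i -> injective i -> lhom g ->
    exists h : B -> E, lhom h /\ forall a, h (i a) = g a.

Definition flat (F : rmod R) : Prop :=
  forall (A B : lmod R) (f : A -> B), lhom f -> injective f -> tensor_inj F f.

Definition preenvelope (P : lmod R -> Prop) (A E : lmod R) (f : A -> E) : Prop :=
  [/\ lhom f, P E &
    forall (E' : lmod R) (g : A -> E'), P E' -> lhom g ->
      exists h : E -> E', lhom h /\ forall a, h (f a) = g a].

Definition precover (P : rmod R -> Prop) (F M : rmod R) (p : F -> M) : Prop :=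
  [/\ rhom p, P F &
    forall (F' : rmod R) (g : F' -> M), P F' -> rhom g ->
      exists h : F' -> F, rhom h /\ forall x, p (h x) = g x].

Definition zadd (M : lmod R) (phi : M -> QZ) : Prop :=
  forall x y, phi (ladd x y) = phi x + phi y.

Definition charcar (M : lmod R) := {phi : M -> QZ | zadd phi}.

Section Char.
Variable M : lmod R.

Lemma char_eq (a b : charcar M) : (forall m, sval a m = sval b m) -> a = b.
Proof.
case: a b => [a Ha] [b Hb] /= E.
have E' : a = b by apply: functional_extensionality.
subst b; congr exist; exact: proof_irrelevance.
Qed.

Lemma zadd0 : zadd (M := M) (fun _ => 0). Proof. by move=> x y; rewrite addr0. Qed.
Definition czero : charcar M := exist _ _ zadd0.

Lemma zaddD (a b : charcar M) : zadd (fun m => sval a m + sval b m).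
Proof.
case: a b => [a Ha] [b Hb] x y /=; rewrite Ha Hb.
by rewrite -!addrA; congr (_ + _); rewrite addrCA.
Qed.
Definition cadd (a b : charcar M) : charcar M := exist _ _ (zaddD a b).

Lemma zaddN (a : charcar M) : zadd (fun m => - sval a m).
Proof. by case: a => a Ha x y /=; rewrite Ha opprD. Qed.
Definition copp (a : charcar M) : charcar M := exist _ _ (zaddN a).

Lemma zaddS (a : charcar M) (r : R) : zadd (fun m => sval a (lscale r m)).
Proof. by case: a => a Ha x y /=; rewrite lscaleDr Ha. Qed.
Definition cscale (a : charcar M) (r : R) : charcar M := exist _ _ (zaddS a r).

Lemma caddA x y z : cadd x (cadd y z) = cadd (cadd x y) z.
Proof. by apply: char_eq => m /=; rewrite addrA. Qed.
Lemma caddC x y : cadd x y = cadd y x.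
Proof. by apply: char_eq => m /=; rewrite addrC. Qed.
Lemma cadd0 x : cadd czero x = x.
Proof. by apply: char_eq => m /=; rewrite add0r. Qed.
Lemma caddN x : cadd (copp x) x = czero.
Proof. by apply: char_eq => m /=; rewrite addNr. Qed.
Lemma cscaleA x r s : cscale (cscale x r) s = cscale x (r * s).
Proof. by apply: char_eq => m /=; rewrite lscaleA. Qed.
Lemma cscale1 x : cscale x 1 = x.
Proof. by apply: char_eq => m /=; rewrite lscale1. Qed.
Lemma cscaleDl x y r : cscale (cadd x y) r = cadd (cscale x r) (cscale y r).
Proof. by apply: char_eq. Qed.
Lemma cscaleDr x r s : cscale x (r + s) = cadd (cscale x r) (cscale x s).
Proof. by apply: char_eq => m /=; rewrite lscaleDl; case: x => x Hx /=; rewrite Hx. Qed.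

Definition charmod : rmod R :=
  @RMod R (charcar M) czero cadd copp cscale caddA caddC cadd0 caddN
    cscaleA cscale1 cscaleDl cscaleDr.
End Char.

Lemma zadd_comp (A E : lmod R) (f : A -> E) (hf : lhom f) (a : charcar E) :
  zadd (fun x => sval a (f x)).
Proof. by case: a => a Ha x y /=; rewrite (proj1 hf) Ha. Qed.

Definition dualmap (A E : lmod R) (f : A -> E) (hf : lhom f) :
  charmod E -> charmod A := fun a => exist _ _ (zadd_comp hf a).

Definition lspan (n : nat) (g : 'I_n -> R) (x : R) : Prop :=
  exists c : 'I_n -> R, x = \sum_(i < n) c i * g i.

(* the kernel of R^n -> R, e_i |-> g_i, is a finitely generated submodule *)
Definition fg_relations (n : nat) (g : 'I_n -> R) : Prop :=
  exists (m : nat) (h : 'I_m -> 'I_n -> R),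
    forall r : 'I_n -> R,
      (\sum_(i < n) r i * g i = 0) <->
      exists c : 'I_m -> R, r = fun i => \sum_(j < m) c j * h j i.

(* every finitely generated left ideal is finitely presented *)
Definition left_coherent : Prop :=
  forall (n : nat) (g : 'I_n -> R),
    exists (n' : nat) (g' : 'I_n' -> R),
      (forall x, lspan g x <-> lspan g' x) /\ fg_relations g'.

End Modules.

(* Main.v *)
Require Import Defs.
From Stdlib Require Import Classical ClassicalEpsilon FunctionalExtensionality ProofIrrelevance.
From HB Require Import structures.
From mathcomp Require Import all_boot all_order all_algebra.
From mathcomp Require Import boolp classical_sets functions.
Set Implicit Arguments.
Unset Strict Implicit.
Unset Printing Implicit Defensive.
Import Order.TTheory GRing.Theory Num.Theory.
Local Open Scope ring_scope.

(* Tensors are handled through balanced maps to Q/Z, which detect whether a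
   tensor vanishes because Q/Z is an injective cogenerator of abelian groups.
   A right module F is flat iff every relation sum_i x_i g_i = 0 in F has the
   form x_i = sum_j y_j h_ji with sum_i h_ji g_i = 0 in R for all j; that this
   suffices follows from Baer's criterion applied to F^+.

   If f : A -> E is injective and E^+ is flat, then f^+ is a flat precover: a
   map F -> A^+ is a character of F (x) A, which extends along the injection
   F (x) A -> F (x) E.  If R is left coherent and E is absolutely pure, E^+ is
   flat: for g in R^n whose relations are generated by the rows of h, the
   sequence E -> E^n -> E^m given by g and h is exact, and so is its dual.

   Conversely, the identity of an absolutely pure E is an absolutely pure
   preenvelope, so E^+ is flat.  With E a power of R^+, a suitable relation
   among characters of E shows that the relations of g are finitely
   generated. *)

(** * Additive maps *)

Section AdditiveMaps.
Variables (V W : zmodType) (phi : V -> W).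
Hypothesis phiD : {morph phi : x y / x + y}.

Lemma addmorph0 : phi 0 = 0.
Proof. by apply: (@addrI _ (phi 0)); rewrite -phiD !addr0. Qed.

Lemma addmorphN : {morph phi : x / - x}.
Proof. by move=> x; apply: (@addrI _ (phi x)); rewrite -phiD !subrr addmorph0. Qed.

Lemma addmorphB : {morph phi : x y / x - y}.
Proof. by move=> x y; rewrite phiD addmorphN. Qed.

Lemma addmorph_sum I (r : seq I) (P : pred I) (F : I -> V) :
  phi (\sum_(i <- r | P i) F i) = \sum_(i <- r | P i) phi (F i).
Proof. exact: (big_morph _ phiD addmorph0). Qed.

Lemma addmorphMz x (n : int) : phi (x *~ n) = phi x *~ n.
Proof.
have Mn (k : nat) : phi (x *+ k) = phi x *+ k.
  by elim: k => [|k IH]; rewrite ?addmorph0 // !mulrS phiD IH.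
by case: n => n; rewrite ?NegzE ?mulrNz ?addmorphN -!pmulrn Mn.
Qed.

End AdditiveMaps.

Lemma sum_fibers_eq0 (V : zmodType) (T I : eqType) (k : I -> T) (F : I -> V) (s : seq I) :
  (forall t, \sum_(p <- s | k p == t) F p = 0) -> \sum_(p <- s) F p = 0.
Proof.
move=> s0; pose U := undup (map k s).
have E p : p \in s -> F p = \sum_(t <- U) (if k p == t then F p else 0).
  move=> ps; rewrite (bigD1_seq (k p)) ?undup_uniq ?mem_undup ?map_f //=.
  by rewrite eqxx big1 ?addr0 // => t /negPf; rewrite eq_sym => ->.
rewrite big_seq (eq_bigr _ E) -big_seq exchange_big /= big1 // => t _.
by rewrite -big_mkcond.
Qed.

Section Single.
Variables (n : nat) (V : zmodType).

Definition single (i : 'I_n) (v : V) : 'I_n -> V := fun k => if k == i then v else 0.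

Lemma singleD i : {morph single i : x y / x + y}.
Proof.
move=> x y; apply/funext => k; rewrite /single /GRing.add /=.
by case: eqP; rewrite ?addr0.
Qed.

Lemma sum_single (v : 'I_n -> V) : \sum_i single i (v i) = v.
Proof.
apply/funext => k; rewrite fct_sumE (bigD1 k) //= /single eqxx big1 ?addr0 //.
by move=> i /negPf; rewrite eq_sym => ->.
Qed.

End Single.

(** * Baer's criterion *)

Section Baer.
Variables (R : nzRingType) (B E : lmodType R).

(** A partial linear map, kept as a set of pairs so that chains of extensions have unions. The last
    clause is single-valuedness over 0, which linearity spreads to every point. *)
Definition linear_graph (G : set (B * E)) : Prop :=
  [/\ G (0, 0),
      forall p q, G p -> G q -> G (p.1 + q.1, p.2 + q.2),
      forall r p, G p -> G (r *: p.1, r *: p.2)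
    & forall e, G (0, e) -> e = 0].

Definition baer_property : Prop :=
  forall (J : R -> Prop) (u : R -> E), J 0 ->
    (forall a b, J a -> J b -> J (a + b) /\ u (a + b) = u a + u b) ->
    (forall r a, J a -> J (r * a) /\ u (r * a) = r *: u a) ->
    exists e, forall a, J a -> u a = a *: e.

Lemma linear_graph_fun G : linear_graph G ->
  forall b e e', G (b, e) -> G (b, e') -> e = e'.
Proof.
move=> [_ GD GZ G0] b e e' He He'; apply/eqP; rewrite -subr_eq0; apply/eqP.
apply: G0; have := GD _ _ He (GZ (-1) _ He'); rewrite /= !scaleN1r.
by rewrite subrr.
Qed.

(** The scalars [r] with [r *: b] in the domain form a left ideal, on which the map has the form
    [r *: e0]; sending [b] to [e0] is then consistent. *)
Lemma linear_graph_extend G (b : B) : baer_property -> linear_graph G ->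
  exists G', [/\ linear_graph G', (G `<=` G')%classic & exists e, G' (b, e)].
Proof.
move=> baerE lG; have [G00 GD GZ G0] := lG.
have Gfun := linear_graph_fun lG.
pose J r := exists e, G (r *: b, e).
pose u r := epsilon (inhabits 0) (fun e => G (r *: b, e)).
have uP r : J r -> G (r *: b, u r) by move=> Jr; exact: (epsilon_spec (inhabits 0) _ Jr).
have uE r e : G (r *: b, e) -> u r = e.
  by move=> Gr; apply: (Gfun _ _ _ _ Gr); apply: uP; exists e.
have [|r s Jr Js|r s Js|e0 e0P] := baerE J u.
- by exists 0; rewrite scale0r.
- have H : G ((r + s) *: b, u r + u s).
    by rewrite scalerDl; exact: GD (uP _ Jr) (uP _ Js).
  by split; [exists (u r + u s) | apply: uE].
- have H : G ((r * s) *: b, r *: u s).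
    by rewrite -scalerA; exact: GZ (uP _ Js).
  by split; [exists (r *: u s) | apply: uE].
exists (fun p => exists q r, G q /\ p = (q.1 + r *: b, q.2 + r *: e0)); split.
- split.
  + by exists (0, 0), 0; rewrite !scale0r !addr0.
  + move=> _ _ [q [r [Gq ->]]] [q' [r' [Gq' ->]]] /=.
    exists (q.1 + q'.1, q.2 + q'.2), (r + r'); split; first exact: GD.
    by rewrite /= !scalerDl addrACA [X in (_, X)]addrACA.
  + move=> s _ [q [r [Gq ->]]]; exists (s *: q.1, s *: q.2), (s * r).
    by split; [exact: GZ | rewrite /= !scalerDr !scalerA].
  (* If [d + r *: b = 0], then [d] is [(- r) *: b] and has value [(- r) *: e0], so the second
     coordinates cancel. *)
  + move=> e [[d d'] [r [Gq [/eqP]]]]; rewrite /= eq_sym addr_eq0 => /eqP dE ->.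
    have H : G ((- r) *: b, d') by rewrite scaleNr -dE.
    rewrite -(uE _ _ H) e0P; last by exists d'.
    by rewrite scaleNr addNr.
- by move=> [d d'] Gd; exists (d, d'), 0; rewrite !scale0r !addr0.
- by exists e0, (0, 0), 1; rewrite !scale1r !add0r.
Qed.

Lemma baer G : baer_property -> linear_graph G ->
  exists psi : B -> E, [/\ {morph psi : x y / x + y},
    forall r, {morph psi : x / r *: x} & forall b e, G (b, e) -> psi b = e].
Proof.
move=> baerE lG.
(* Joining [G] to every candidate makes the empty chain admissible. *)
pose P (X : set (B * E)) := linear_graph (G `|` X)%classic.
have [F FP Ftot|M [PM Mmax]] := @Zorn_bigcup _ P.
  have [->|/set0P [X0 FX0]] := eqVneq F set0.
    by rewrite /P bigcup_set0 setU0.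
  have sub X : F X -> (G `|` X `<=` G `|` \bigcup_(X in F) X)%classic.
    by move=> FX p [Gp|Xp]; [left|right; exists X].
  have join p q : (G `|` \bigcup_(X in F) X)%classic p ->
      (G `|` \bigcup_(X in F) X)%classic q ->
      exists X, [/\ F X, (G `|` X)%classic p & (G `|` X)%classic q].
    move=> [Gp|[X FX Xp]] [Gq|[Y FY Yq]].
    - by exists X0; split => //; left.
    - by exists Y; split => //; [left|right].
    - by exists X; split => //; [right|left].
    - have [XY|YX] := Ftot _ _ FX FY.
        by exists Y; split => //; right => //; exact: XY.
      by exists X; split => //; right => //; exact: YX.
  split.
  - by left; have [] := lG.
  - move=> p q Hp Hq; have [X [FX Xp Xq]] := join _ _ Hp Hq.
    by apply: (sub _ FX); have [_ XD _ _] := FP _ FX; exact: XD.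
  - move=> r p Hp; have [X [FX Xp _]] := join _ _ Hp Hp.
    by apply: (sub _ FX); have [_ _ XZ _] := FP _ FX; exact: XZ.
  - move=> e He; have [X [FX Xe _]] := join _ _ He He.
    by have [_ _ _ X0e] := FP _ FX; exact: X0e.
pose N := (G `|` M)%classic.
(* A one-step extension at [b] cannot be strictly larger than the maximal [M]. *)
have dom b : exists e, N (b, e).
  have [N' [lN' NN' [e N'e]]] := linear_graph_extend b baerE PM.
  exists e; right; apply: contrapT => nMe; apply: (Mmax N').
    split; first by move=> p Mp; apply: NN'; right.
    by move=> /(_ _ N'e).
  rewrite /P (_ : (G `|` N')%classic = N') //; apply/seteqP; split.
    by move=> p [Gp|//]; apply: NN'; left.
  by move=> p; right.
have [psi psiP] := choice dom.
have [_ ND NZ _] := PM; have Nfun := linear_graph_fun PM.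
exists psi; split=> [x y|r x|b e Ge].
- by apply: (Nfun _ _ _ (psiP _)); exact: ND (psiP x) (psiP y).
- by apply: (Nfun _ _ _ (psiP _)); exact: NZ (psiP x).
- by apply: (Nfun _ _ _ (psiP _)); left.
Qed.

End Baer.

(** * The injective cogenerator Q/Z *)

(** The least positive element generates, by Euclidean division; if there is none, [k] is 0. *)
Lemma int_ideal_principal (J : int -> Prop) : J 0 ->
  (forall a b, J a -> J b -> J (a + b)) -> (forall r a, J a -> J (r * a)) ->
  exists k : nat, forall n, J n <-> (k%:Z %| n)%Z.
Proof.
move=> J0 JD JM.
have [[k0 [k0gt0 Jk0]]|nJ] := pselect (exists k : nat, (0 < k)%N /\ J k%:Z).
  have ex : exists k : nat, (0 < k)%N && `[< J k%:Z >].
    by exists k0; rewrite k0gt0; apply/asboolP.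
  case: (ex_minnP ex) => k /andP[k_gt0 /asboolP Jk] kmin; exists k => n.
  split=> [Jn|/dvdzP[q ->]]; last exact: JM.
  have k_neq0 : k%:Z != 0 by rewrite -lt0n.
  have Jmod : J (n %% k)%Z.
    by rewrite /modz -mulNr; apply: JD => //; exact: JM.
  apply/dvdz_mod0P; have := modz_ge0 n k_neq0.
  have := @ltz_pmod n k k_gt0.
  case: (n %% k)%Z Jmod => // m Jm; rewrite ltz_nat => ltmk _.
  case: m Jm ltmk => // m Jm ltmk.
  suff : (k <= m.+1)%N by rewrite leqNgt ltmk.
  by apply: kmin; apply/asboolP.
exists 0%N => n; rewrite dvd0z; split=> [Jn|/eqP->//].
apply/negPn/negP => n0; apply: nJ; exists `|n|%N; rewrite absz_gt0; split => //.
by rewrite abszE normrEsg; apply: JM.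
Qed.

Lemma qz_ofD : {morph qz_of : x y / x + y}.
Proof. by move=> x y; apply: qz_eq => /=; rewrite fracDl fracDr. Qed.

Lemma qz_of_int (n : int) : qz_of n%:~R = 0.
Proof. by apply: qz_eq; rewrite /= -[n%:~R]add0r frac_shift frac0. Qed.

Lemma qz_ofK (q : QZ) : qz_of (sval q) = q.
Proof. by apply: qz_eq; rewrite /= qz_val. Qed.

Lemma QZ_divisible (k : nat) (q : QZ) : (0 < k)%N -> exists q', q' *~ k = q.
Proof.
move=> k_gt0; exists (qz_of (sval q / k%:~R)).
rewrite -(addmorphMz qz_ofD) -mulrzr divfK ?qz_ofK //.
by rewrite intr_eq0 -lt0n.
Qed.

Lemma QZ_order (k : nat) : k != 1%N ->
  (* The class of 1/k works; for k = 0 only n = 0 is divisible, and 1/2 serves. *)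
  exists q : QZ, q != 0 /\ forall n, (k%:Z %| n)%Z -> q *~ n = 0.
Proof.
move=> k1; pose m := if k == 0%N then 2%N else k.
have m_gt1 : (1 < m)%N by rewrite /m; case: (k) k1 => [|[|]].
exists (qz_of (m%:~R)^-1); split.
  apply/eqP => /(congr1 sval) /= /eqP.
  rewrite /Defs.frac (_ : Num.floor _ = 0) ?subr0 ?invr_eq0 ?intr_eq0; last first.
    apply: floor_def; rewrite add0r invr_ge0 ler0z /=.
    by rewrite invf_lt1 ?ltr1z ?ltr0z // ltz_nat ltnW.
  by case: (m) m_gt1.
move=> n kn; have /dvdzP[q ->] : (m%:Z %| n)%Z.
  by move: kn; rewrite /m; case: eqP => // ->; rewrite dvd0z => /eqP->.
rewrite -(addmorphMz qz_ofD) -mulrzr intrM mulrCA mulVf ?mulr1 ?qz_of_int //.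
by rewrite intr_eq0; case: (m) m_gt1.
Qed.

(** Injectivity of Q/Z, by Baer's criterion over [int]: ideals are principal, and a value at the
    generator can be divided by it. The partial map is a relation [G], so its domain is never built
    as a type. *)
Lemma QZ_ext (V : zmodType) (G : V -> QZ -> Prop) :
  G 0 0 -> (forall v w p q, G v p -> G w q -> G (v - w) (p - q)) ->
  (forall q, G 0 q -> q = 0) ->
  exists psi : V -> QZ, {morph psi : x y / x + y} /\ forall v q, G v q -> psi v = q.
Proof.
move=> G0 GB Gfun.
have GN v q : G v q -> G (- v) (- q) by move=> /(GB _ _ _ _ G0); rewrite !sub0r.
have GD v w p q : G v p -> G w q -> G (v + w) (p + q).
  by move=> Gv /GN Gw; have := GB _ _ _ _ Gv Gw; rewrite !opprK.
have GMn v q (n : nat) : G v q -> G (v *+ n) (q *+ n).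
  by move=> Gv; elim: n => [|n IH]; rewrite ?mulr0n // !mulrS; apply: GD.
have GMz v q (n : int) : G v q -> G (v *~ n) (q *~ n).
  by move=> Gv; case: n => n; rewrite ?NegzE ?mulrNz -!pmulrn;
    [|apply: GN]; apply: GMn.
have baerQZ : @baer_property int (zmodule QZ).
  move=> J u J0 JD JM; have JM' r a : J a -> J (r * a) by move=> /(JM r) [].
  have [k kP] := int_ideal_principal J0 (fun a b Ja Jb => proj1 (JD a b Ja Jb)) JM'.
  have uM (t : int) : u (t * k%:Z) = t *: u k by apply: (proj2 (JM _ _ _)); apply/kP.
  have [k0|k_gt0] := posnP k.
    exists 0 => a /kP; rewrite k0 dvd0z => /eqP->; rewrite scaler0.
    by have := uM 0; rewrite mul0r scale0r.
  have [q qP] := QZ_divisible (u k) k_gt0.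
  exists q => a /kP /dvdzP[t ->]; rewrite uM -scalerA; congr (_ *: _).
  by rewrite -qP.
have lG : @linear_graph int (zmodule V) (zmodule QZ) (fun p => G p.1 p.2).
  split=> // [p q|r p] Gp; first exact: GD.
  exact: (GMz _ _ r Gp).
have [psi [psiD _ psiP]] := baer baerQZ lG.
by exists psi; split => // v q /(psiP v q).
Qed.

(** The integers [n] with [v *~ n] in [H] form an ideal with generator [k], and [k] is not 1 because
    [v] is outside [H]. A nonzero [q] killed by [k] is then a consistent value for [v]. *)
Lemma QZ_separates (V : zmodType) (H : V -> Prop) (v : V) :
  H 0 -> (forall x y, H x -> H y -> H (x - y)) -> ~ H v ->
  exists psi : V -> QZ, [/\ {morph psi : x y / x + y},
    forall x, H x -> psi x = 0 & psi v != 0].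
Proof.
move=> H0 HB Hv.
have HN x : H x -> H (- x) by move=> /(HB _ _ H0); rewrite sub0r.
have HD x y : H x -> H y -> H (x + y).
  by move=> Hx /HN Hy; rewrite -[y]opprK; apply: HB.
have HMz x (n : int) : H x -> H (x *~ n).
  have HMn (m : nat) : H x -> H (x *+ m).
    by move=> Hx; elim: m => [|m IH]; rewrite ?mulr0n // mulrS; apply: HD.
  by move=> Hx; case: n => n; rewrite ?NegzE ?mulrNz -!pmulrn;
    [|apply: HN]; apply: HMn.
have [|a b|r a|k kP] := @int_ideal_principal (fun n => H (v *~ n)).
- by rewrite mulr0z.
- by rewrite mulrzDr; exact: HD.
- by rewrite mulrC mulrzA; apply: HMz.
have k1 : k != 1%N by apply/eqP => k1; apply: Hv; rewrite -[v]mulr1z; apply/kP; rewrite k1.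
have [q [q0 qP]] := QZ_order k1.
pose G x p := exists h (n : int), [/\ H h, x = h + v *~ n & p = q *~ n].
have [||p|psi [psiD psiP]] := @QZ_ext V G.
- by exists 0, 0; rewrite !mulr0z addr0.
- move=> x y p p' [h [n [Hh -> ->]]] [h' [n' [Hh' -> ->]]].
  exists (h - h'), (n - n'); split; first exact: HB.
    by rewrite mulrzBr opprD addrACA.
  by rewrite mulrzBr.
- move=> [h [n [Hh /eqP]]]; rewrite eq_sym addr_eq0 => /eqP hE ->.
  by apply: qP; apply/kP; rewrite -[_ *~ _]opprK -hE; apply: HN.
exists psi; split => // [x Hx|].
  by apply: psiP; exists x, 0; rewrite !mulr0z addr0.
by rewrite (psiP v q) //; exists 0, 1; rewrite add0r !mulr1z.
Qed.

(** * Tensor products and balanced maps *)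

HB.instance Definition _ (R : nzRingType) (M : lmod R) := gen_eqMixin (lcar M).
HB.instance Definition _ (R : nzRingType) (M : lmod R) := gen_choiceMixin (lcar M).
HB.instance Definition _ (R : nzRingType) (M : lmod R) :=
  GRing.isZmodule.Build (lcar M) (@laddA R M) (@laddC R M) (@ladd0 R M) (@laddN R M).
HB.instance Definition _ (R : nzRingType) (M : lmod R) :=
  GRing.Zmodule_isLmodule.Build R (lcar M) (@lscaleA R M) (@lscale1 R M)
    (@lscaleDr R M) (fun x r s => @lscaleDl R M r s x).
HB.instance Definition _ (R : nzRingType) (M : rmod R) := gen_eqMixin (rcar M).
HB.instance Definition _ (R : nzRingType) (M : rmod R) := gen_choiceMixin (rcar M).
HB.instance Definition _ (R : nzRingType) (M : rmod R) :=
  GRing.isZmodule.Build (rcar M) (@raddA R M) (@raddC R M) (@radd0 R M) (@raddN R M).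

Section Balanced.
Variable R : nzRingType.
Implicit Types (X F : rmod R) (M N A B : lmod R).

Lemma rscale0 X (x : X) : rscale x 0 = 0.
Proof. exact: (addmorph0 (rscaleDr x)). Qed.

Lemma lhomD M N (f : M -> N) : lhom f -> {morph f : x y / x + y}.
Proof. by case. Qed.

Lemma lhomZ M N (f : M -> N) : lhom f -> forall r, {morph f : x / r *: x}.
Proof. by case. Qed.

Definition balanced X M (b : X -> M -> QZ) : Prop :=
  [/\ forall m, {morph b^~ m : x y / x + y},
      forall x, {morph b x : m n / m + n}
    & forall x r m, b (rscale x r) m = b x (r *: m)].

Lemma deltaE X M (x : X) (m : M) a b :
  delta x m a b = ((a, b) == (x, m))%:R.
Proof.
rewrite /delta; case: excluded_middle_informative => H /=; first by case: H => -> ->; rewrite eqxx.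
by case: eqP => // -[? ?]; case: H.
Qed.

Lemma sum_eq_indicator (T : eqType) (b : T -> QZ) (c : seq (int * T)) :
  (forall q, \sum_(p <- c) p.1 * (q == p.2)%:R = 0) ->
  \sum_(p <- c) b p.2 *~ p.1 = 0.
Proof.
move=> c0; apply: (@sum_fibers_eq0 _ _ _ snd) => q.
rewrite (eq_bigr (fun p => b q *~ p.1)) => [|p /eqP-> //].
rewrite -mulrz_sumr (_ : \sum_(p <- c | _) _ = 0) ?mulr0z //.
rewrite -[RHS](c0 q) big_mkcond; apply: eq_bigr => p _.
by rewrite eq_sym; case: eqP; rewrite ?mulr1 ?mulr0.
Qed.

(** Elements of [fsum] may have infinite support, so [b] does not extend to them by a sum. Instead
    each relation is represented by a finite combination [c] of generators on which [b] takes the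
    value 0. *)
Lemma balanced_tensor_zero X M (b : X -> M -> QZ) s :
  balanced b -> tensor_zero s -> \sum_(p <- s) b p.1 p.2 = 0.
Proof.
move=> [bl br bs].
suff repr f : tensor_rel f -> exists c : seq (int * (X * M)),
    (forall q, f q.1 q.2 = \sum_(p <- c) p.1 * (q == p.2)%:R) /\
    \sum_(p <- c) b p.2.1 p.2.2 *~ p.1 = 0.
  move=> /repr[c [fE c0]].
  (* Subtracting [s] from [c] leaves a combination that is zero as a function, so [b] takes the same
     value on both. *)
  have := @sum_eq_indicator _ (fun q => b q.1 q.2)
    (c ++ [seq (-1, p) | p <- s]); rewrite big_cat /= c0 add0r big_map.
  under eq_bigr do rewrite mulrNz mulr1z.
  rewrite sumrN => /(_ _)/eqP; rewrite oppr_eq0 => H; apply/eqP/H => q.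
  rewrite big_cat big_map /= -fE; under eq_bigr do rewrite mulN1r.
  rewrite sumrN /fsum_of; apply/eqP; rewrite subr_eq0; apply/eqP/eq_bigr => p _.
  by rewrite deltaE -!surjective_pairing.
elim=> {f} [|f g _ [c [fE c0]] _ [d [gE d0]]|f _ [c [fE c0]]|x y m|x m n|x r m].
- by exists [::]; split=> [q|]; rewrite big_nil.
- by exists (c ++ d); split=> [q|]; rewrite big_cat /= -?fE -?gE ?c0 ?d0 ?addr0.
- exists [seq (- p.1, p.2) | p <- c]; split=> [q|]; rewrite big_map /=.
    by under eq_bigr do rewrite mulNr; rewrite sumrN fE.
  by under eq_bigr do rewrite mulrNz; rewrite sumrN c0 oppr0.
- exists [:: (1, (x + y, m)); (-1, (x, m)); (-1, (y, m))]; split=> [q|].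
    by rewrite !big_cons big_nil /= !deltaE -!surjective_pairing !mul1r !mulN1r addr0 addrA.
  by rewrite !big_cons big_nil /= bl !mulrNz !mulr1z addr0 -opprD subrr.
- exists [:: (1, (x, m + n)); (-1, (x, m)); (-1, (x, n))]; split=> [q|].
    by rewrite !big_cons big_nil /= !deltaE -!surjective_pairing !mul1r !mulN1r addr0 addrA.
  by rewrite !big_cons big_nil /= br !mulrNz !mulr1z addr0 -opprD subrr.
- exists [:: (1, (rscale x r, m)); (-1, (x, r *: m))]; split=> [q|].
    by rewrite !big_cons big_nil /= !deltaE -!surjective_pairing !mul1r !mulN1r addr0.
  by rewrite !big_cons big_nil /= bs !mulrNz !mulr1z addr0 subrr.
Qed.

Lemma fsum_ofE X M (s : seq (X * M)) :
  fsum_of s = \sum_(p <- s) (delta p.1 p.2 : X -> M -> int).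
Proof. by apply/funext => x; apply/funext => m; rewrite !fct_sumE. Qed.

Lemma tensor_relB X M (f g : X -> M -> int) :
  tensor_rel f -> tensor_rel g -> tensor_rel (f - g).
Proof. by move=> Hf Hg; exact: (treladd Hf (trelopp Hg)). Qed.

Lemma balanced_of_character X M (psi : (X -> M -> int) -> QZ) :
  {morph psi : f g / f + g} -> (forall f, tensor_rel f -> psi f = 0) ->
  balanced (fun x m => psi (delta x m)).
Proof.
move=> psiD psi0; have psiB := addmorphB psiD.
split=> [m x y|x m n|x r m]; apply/eqP; rewrite -subr_eq0 ?opprD ?addrA -!psiB;
  apply/eqP/psi0.
- exact: trelL.
- exact: trelR.
- exact: trelS.
Qed.

(** The relations form a subgroup, and Q/Z separates it from any function outside it. *)
Lemma tensor_relP X M (f : X -> M -> int) :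
  (forall psi : (X -> M -> int) -> QZ, {morph psi : g h / g + h} ->
    (forall g, tensor_rel g -> psi g = 0) -> psi f = 0) -> tensor_rel f.
Proof.
move=> H; apply: contrapT => nf.
have [||psi [psiD psi0 /eqP[]]] :=
  @QZ_separates (X -> M -> int) (@tensor_rel R X M) f _ _ nf.
- exact: trel0.
- exact: tensor_relB.
exact: H.
Qed.

Lemma tensor_zeroP X M (s : seq (X * M)) :
  tensor_zero s <-> forall b, balanced b -> \sum_(p <- s) b p.1 p.2 = 0.
Proof.
split=> [s0 b bb|H]; first exact: balanced_tensor_zero.
apply: tensor_relP => psi psiD psi0; rewrite fsum_ofE (addmorph_sum psiD).
exact: H _ (balanced_of_character psiD psi0).
Qed.

(** Lists of pairs carry no coefficients; differences of tensors are formed by negating first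
    components. *)
Lemma tensor_rel_neg X M (s : seq (X * M)) :
  tensor_rel (fsum_of [seq (- p.1, p.2) | p <- s] + fsum_of s : X -> M -> int).
Proof.
apply: tensor_relP => psi psiD psi0.
have [bl _ _] := balanced_of_character psiD psi0.
rewrite psiD !fsum_ofE !(addmorph_sum psiD) big_map -big_split big1 // => p _ /=.
by rewrite (addmorphN (bl p.2)) addNr.
Qed.

Lemma tensor_zero_map X A B (f : A -> B) (s : seq (X * A)) :
  lhom f -> tensor_zero s -> tensor_zero [seq (p.1, f p.2) | p <- s].
Proof.
move=> /[dup] /lhomD fD /lhomZ fZ /tensor_zeroP s0; apply/tensor_zeroP => b [bl br bs].
rewrite big_map; apply: (s0 (fun x a => b x (f a))); split=> // [x m n|x r m].
  by rewrite fD br.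
by rewrite bs fZ.
Qed.

(** * Flatness through relations *)

Definition flat_relations F : Prop :=
  forall n (x : 'I_n -> F) (g : 'I_n -> R), \sum_i rscale (x i) (g i) = 0 ->
  exists m (y : 'I_m -> F) (h : 'I_m -> 'I_n -> R),
    (forall i, x i = \sum_j rscale (y j) (h j i)) /\
    (forall j, \sum_i h j i * g i = 0).

(** Viewing a right module as a left module over the converse ring lets the character construction
    be reused for it. *)
Definition opp_lmod X : lmod R^c :=
  @LMod R^c X _ _ _ (fun r x => rscale x r) (@raddA R X) (@raddC R X) (@radd0 R X)
    (@raddN R X) (fun r s x => rscaleA x s r) (@rscale1 R X)
    (fun r x y => rscaleDl x y r) (fun r s x => rscaleDr x r s).

(** The left module X^+, with (r a)(x) = a(x r). *)
Definition rdual X : lmod R :=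
  let D := opp_lmod X in
  @LMod R (charcar D) _ _ _ (fun r a => @cscale R^c D a r)
    (@caddA _ D) (@caddC _ D) (@cadd0 _ D) (@caddN _ D)
    (fun r s a => @cscaleA _ D a s r) (@cscale1 _ D)
    (fun r a b => @cscaleDl _ D a b r) (fun r s a => @cscaleDr _ D a r s).

(** A linear map [u] from [J] to F^+ amounts to a character of F (x) J. By the hypothesis on
    relations its value depends only on the element sum_i x_i a_i of F; extending it to F gives the
    required element of F^+. *)
Lemma baer_rdual F : flat_relations F -> baer_property (rdual F).
Proof.
move=> relF J u J0 JD JM.
have u0 : u 0 = 0 by rewrite -[0 in LHS](mul0r 0) (proj2 (JM 0 0 J0)) scale0r.
have usum n (a : 'I_n -> R) : (forall i, J (a i)) -> u (\sum_i a i) = \sum_i u (a i).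
  move=> Ja; apply: (proj2 (A := J (\sum_i a i))).
  elim/big_rec2: _ => [//|i y z _ [Jz uz]].
  by have [JD1 JD2] := JD _ _ (Ja i) Jz; rewrite -uz.
have valD y : {morph (fun c : rdual F => sval c y) : c d / c + d} by [].
have cD (c : rdual F) : {morph (sval c : F -> QZ) : x y / x + y} := svalP c.
pose G (v : F) q := exists s : seq (F * R), [/\ forall p, p \in s -> J p.2,
  v = \sum_(p <- s) rscale p.1 p.2 & q = \sum_(p <- s) sval (u p.2) p.1].
have [||q|psi [psiD psiP]] := @QZ_ext F G.
- by exists [::]; rewrite !big_nil.
- move=> _ _ _ _ [s [Js -> ->]] [t [Jt -> ->]].
  exists (s ++ [seq (- p.1, p.2) | p <- t]); split.
  + move=> p; rewrite mem_cat => /orP[/Js //|/mapP[p' /Jt Jp' ->]] //.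
  + rewrite big_cat big_map /= -sumrN; congr (_ + _); apply: eq_bigr => p _.
    by rewrite (addmorphN (phi := fun x => rscale x p.2) (fun x y => rscaleDl x y p.2)).
  + rewrite big_cat big_map /= -sumrN; congr (_ + _); apply: eq_bigr => p _.
    by rewrite (addmorphN (cD _)).
- move=> [s [Js /esym]]; rewrite 2!(big_tnth _ _ s) => /relF[m [y [h [xE hE]]]] ->.
  (* Substituting x_i = sum_j y_j h_ji turns the sum into sum_j u(sum_i h_ji a_i)(y_j), where every
     inner sum is 0. *)
  transitivity (\sum_(j < m) sval (u 0) (y j)); last first.
    by rewrite u0 big1.
  under eq_bigr => i _ do rewrite xE (addmorph_sum (cD _)).
  rewrite exchange_big; apply: eq_bigr => j _ /=.
  rewrite -(hE j) usum => [|i]; last by have [] := JM (h j i) _ (Js _ (mem_tnth i (in_tuple s))).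
  rewrite (addmorph_sum (valD _)); apply: eq_bigr => i _.
  by have [_ ->] := JM (h j i) _ (Js _ (mem_tnth i (in_tuple s))).
exists (exist (@zadd R^c (opp_lmod F)) psi psiD) => a Ja.
apply: char_eq => x /=; symmetry; apply: psiP.
by exists [:: (x, a)]; rewrite !big_seq1; split=> // p; rewrite inE => /eqP->.
Qed.

(** A balanced [b] on F and A is a linear map from A to F^+. By Baer's criterion it extends along
    [f], so the value of [b] on [s] is read off from the image of [s], which vanishes. *)
Lemma flat_relations_flat F : flat_relations F -> flat F.
Proof.
move=> relF A B f /[dup] /lhomD fD /lhomZ fZ finj s fs0.
apply/tensor_zeroP => b [bl br bs].
pose u a : rdual F := exist (@zadd R^c (opp_lmod F)) (b^~ a) (bl a).
have uD : {morph u : x y / x + y} by move=> x y; apply: char_eq => m; exact: br.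
have uZ r : {morph u : x / r *: x} by move=> x; apply: char_eq => m; exact: (esym (bs m r x)).
pose G (p : B * rdual F) := exists a, p = (f a, u a).
have f0 := addmorph0 fD.
have [|psi [psiD psiZ psiP]] := @baer R _ _ G (baer_rdual relF).
  split.
  - by exists 0; rewrite f0 (addmorph0 uD).
  - by move=> _ _ [a ->] [a' ->]; exists (a + a'); rewrite uD fD.
  - by move=> r _ [a ->]; exists (r *: a); rewrite uZ fZ.
  - by move=> e [a [fa ->]]; rewrite (finj a 0) ?(addmorph0 uD) // f0 fa.
have := (@tensor_zeroP _ _ _).1 fs0 (fun x m => sval (psi m) x); rewrite big_map /=.
move=> H; rewrite -[RHS]H.
  by apply: eq_bigr => p _; rewrite (psiP (f p.2) (u p.2)) //; exists p.2.
split=> [m x y|x m n|x r m]; first exact: (svalP (psi m)).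
  by rewrite psiD.
by rewrite psiZ.
Qed.

End Balanced.

(** * Flat modules satisfy the criterion on relations *)

Section Flatness.
Variable R : nzRingType.
Implicit Types (X F : rmod R) (M N A B E : lmod R).

Definition reg_lmod : lmod R :=
  @LMod R R 0 +%R -%R *%R (@addrA R) (@addrC R) (@add0r R) (@addNr R)
    (@mulrA R) (@mul1r R) (@mulrDr R) (@mulrDl R).

Definition reg_rmod : rmod R :=
  @RMod R R 0 +%R -%R *%R (@addrA R) (@addrC R) (@add0r R) (@addNr R)
    (fun x r s => esym (mulrA x r s)) (@mulr1 R) (@mulrDl R) (@mulrDr R).

Section Submodule.
Variables (M : lmod R) (P : M -> Prop).
Hypotheses (P0 : P 0) (PD : forall x y, P x -> P y -> P (x + y))
  (PZ : forall r x, P x -> P (r *: x)).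

Let PN x : P x -> P (- x).
Proof. by move=> /(PZ (-1)); rewrite scaleN1r. Qed.

Let sub_eq (x y : {x | P x}) : sval x = sval y -> x = y.
Proof. by case: x y => [x Px] [y Py] /= E; apply: eq_exist. Qed.

Definition sub_lmod : lmod R.
Proof.
apply: (@LMod R {x | P x} (exist _ 0 P0)
  (fun x y => exist _ (sval x + sval y) (PD (svalP x) (svalP y)))
  (fun x => exist _ (- sval x) (PN (svalP x)))
  (fun r x => exist _ (r *: sval x) (PZ r (svalP x)))) => *; apply: sub_eq => /=.
- exact: addrA.
- exact: addrC.
- exact: add0r.
- exact: addNr.
- exact: scalerA.
- exact: scale1r.
- exact: scalerDr.
- exact: scalerDl.
Defined.
End Submodule.

(** Flatness is tested on the inclusion in R of the left ideal I spanned by [g]. The tensor sum_i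
    x_i (x) g_i vanishes in F (x) R, hence in F (x) I, where a character separating [x] from [N]
    would detect it. *)
Lemma flat_flat_relations F : flat F -> flat_relations F.
Proof.
move=> flatF n x g xg0.
pose N (v : 'I_n -> F) := exists s : seq (F * ('I_n -> R)),
  (forall p, p \in s -> \sum_i p.2 i * g i = 0) /\
  v = fun i => \sum_(p <- s) rscale p.1 (p.2 i).
suff [s [sg xE]] : N x.
  exists (size s), (fun j => (tnth (in_tuple s) j).1), (fun j => (tnth (in_tuple s) j).2).
  by split=> [i|j]; [rewrite xE big_tnth | exact/sg/mem_tnth].
apply: contrapT => nNx.
have [||chi [chiD chiN /eqP chix]] := @QZ_separates _ N x _ _ nNx.
- by exists [::]; split=> //; apply/funext => i; rewrite big_nil.
- move=> _ _ [s [sg ->]] [t [tg ->]].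
  exists (s ++ [seq (- p.1, p.2) | p <- t]); split.
    by move=> p; rewrite mem_cat => /orP[/sg //|/mapP[p' /tg Jp' ->]].
  apply/funext => i; rewrite big_cat big_map /= -[LHS]/(_ - _) -sumrN; congr (_ + _).
  apply: eq_bigr => p _.
  by rewrite (addmorphN (phi := fun x => rscale x (p.2 i)) (fun x y => rscaleDl x y _)).
have span0 : lspan g 0 by exists (fun=> 0); rewrite big1 // => i _; rewrite mul0r.
have spanD a b : lspan g a -> lspan g b -> lspan g (a + b).
  move=> [c ->] [d ->]; exists (c + d); rewrite -big_split; apply: eq_bigr => i _.
  by rewrite /= -mulrDl.
have spanZ r a : lspan g a -> lspan g (r * a).
  move=> [c ->]; exists (fun i => r * c i); rewrite mulr_sumr.
  by apply: eq_bigr => i _; rewrite mulrA.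
pose I := @sub_lmod reg_lmod (lspan g) span0 spanD spanZ.
pose incl (a : I) : reg_lmod := sval a.
have [c cP] := @choice I ('I_n -> R) (fun a c => sval a = \sum_i c i * g i)
  (fun a => svalP a).
pose b (y : F) (a : I) := chi (fun i => rscale y (c a i)).
(* Two choices of coefficients differ by a relation of [g], and [chi] kills [N]. *)
have bE y a d : sval a = \sum_i d i * g i -> b y a = chi (fun i => rscale y (d i)).
  move=> ad; apply/eqP; rewrite -subr_eq0 -(addmorphB chiD); apply/eqP/chiN.
  exists [:: (y, c a - d)]; split=> [p|].
    rewrite inE => /eqP-> /=.
    rewrite (eq_bigr (fun i => c a i * g i - d i * g i)); last by move=> i _; exact: mulrBl.
    by rewrite sumrB -ad -cP subrr.
  apply/funext => i; rewrite big_seq1 /= -[LHS]/(_ - _).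
  by rewrite -(addmorphB (phi := rscale y) (rscaleDr y)).
have bb : balanced b.
  split=> [a y z|y a a'|y r a].
  - by rewrite -chiD; congr chi; apply/funext => i; exact: rscaleDl.
  - rewrite (bE _ _ (c a + c a')); last first.
      rewrite -[LHS]/((sval a : R) + (sval a' : R)) !cP -big_split; apply: eq_bigr => i _.
      by rewrite /= -mulrDl.
    by rewrite -chiD; congr chi; apply/funext => i; exact: rscaleDr.
  - rewrite (bE y _ (fun i => r * c a i)); last first.
      rewrite -[LHS]/(r * (sval a : R)) cP mulr_sumr.
      by apply: eq_bigr => i _; rewrite mulrA.
    by congr chi; apply/funext => i; exact: rscaleA.
have gspan i : lspan g (g i).
  exists (fun k => (k == i)%:R); rewrite (bigD1 i) //= eqxx mul1r big1 ?addr0 //.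
  by move=> k /negPf->; rewrite mul0r.
pose s := [seq (x i, exist _ (g i) (gspan i) : I) | i <- enum 'I_n].
have s0 : tensor_zero s.
  apply: (flatF I reg_lmod incl) => //.
    by move=> [a Pa] [a' Pa'] /= E; apply: eq_exist.
  apply/tensor_zeroP => b' [bl br bs]; rewrite big_map /s big_map big_enum /=.
  (* In F (x) R each term becomes x_i g_i (x) 1. *)
  have bE' i : b' (x i) (incl (exist _ (g i) (gspan i))) = b' (rscale (x i) (g i)) 1.
    by rewrite bs /incl /=; congr b'; rewrite -[RHS]/(g i * 1) mulr1.
  rewrite (eq_bigr _ (fun i _ => bE' i)) -(addmorph_sum (bl _)) xg0.
  exact: (addmorph0 (bl _)).
have := balanced_tensor_zero bb s0; rewrite /s big_map big_enum /= => bs0.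
apply: chix; rewrite -[X in chi X]sum_single (addmorph_sum chiD) -[RHS]bs0.
apply: eq_bigr => i _; rewrite (bE _ _ (fun k => (k == i)%:R)); last first.
  rewrite (bigD1 i) //= eqxx mul1r big1 ?addr0 //.
  by move=> k /negPf->; rewrite mul0r.
congr chi; apply/funext => k; rewrite /single; case: eqP => _.
  by rewrite rscale1.
by rewrite rscale0.
Qed.

(** * Cofree modules *)

Definition prod_lmod (T : Type) (D : lmod R) : lmod R.
Proof.
apply: (@LMod R (T -> D) (fun=> 0) (fun x y t => x t + y t) (fun x t => - x t)
  (fun r x t => r *: x t)) => *; apply: functional_extensionality => t.
- exact: addrA.
- exact: addrC.
- exact: add0r.
- exact: addNr.
- exact: scalerA.
- exact: scale1r.
- exact: scalerDr.
- exact: scalerDl.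
Defined.

(* The dual (R^(T))^+ of the free right module on T. *)
Definition cofree (T : Type) : lmod R := prod_lmod T (rdual reg_rmod).

(** Evaluation at 1 turns a linear map into a cofree module into a family of additive maps to Q/Z,
    each of which extends. *)
Lemma cofree_injective T : injective_mod (cofree T).
Proof.
move=> A B i u /[dup] /lhomD iD /lhomZ iZ i_inj /[dup] /lhomD uD /lhomZ uZ.
have ext t : exists chi : B -> QZ, {morph chi : x y / x + y} /\
    forall a, chi (i a) = sval (u a t) 1.
  have vD : {morph (fun a => sval (u a t) 1) : x y / x + y} by move=> x y; rewrite uD.
  pose G b q := exists a, b = i a /\ q = sval (u a t) 1.
  have [||q|chi [chiD chiP]] := @QZ_ext B G.
  - by exists 0; rewrite (addmorph0 iD) (addmorph0 vD).
  - move=> _ _ _ _ [a [-> ->]] [a' [-> ->]]; exists (a - a').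
    by rewrite (addmorphB iD) (addmorphB vD).
  - move=> [a [ia ->]]; rewrite (i_inj a 0) ?(addmorph0 vD) //.
    by rewrite -ia (addmorph0 iD).
  by exists chi; split=> // a; apply: chiP; exists a.
have [chi chiP] := choice ext.
have chiD t : {morph chi t : x y / x + y} := proj1 (chiP t).
have hD b t : @zadd R^c (opp_lmod reg_rmod) (fun r => chi t (r *: b)).
  by move=> r s; rewrite -chiD; congr (chi t); exact: scalerDl.
exists (fun b t => exist _ _ (hD b t)); split.
  split=> [x y|r x]; apply/funext => t; apply: char_eq => s /=.
    by rewrite -chiD; congr (chi t); exact: scalerDr.
  by congr (chi t); exact: scalerA.
move=> a; apply/funext => t; apply: char_eq => r /=.
rewrite -iZ (proj2 (chiP t)) uZ /=; congr (sval (u a t) _); exact: mul1r.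
Qed.

(** Injectivity gives a retraction of [f], which carries the vanishing tensor back. *)
Lemma injective_abs_pure E : injective_mod E -> abs_pure E.
Proof.
move=> injE B f hf finj; split=> // X s fs0.
have [|h [hh hK]] := injE E B f id hf finj; first by [].
have := tensor_zero_map hh fs0; rewrite -map_comp.
by rewrite (eq_map (g := id)) ?map_id // => -[x a] /=; rewrite hK.
Qed.
End Flatness.

(** * Coherence *)

Section Coherence.
Variable R : nzRingType.
Implicit Types (X F : rmod R) (M N A B E : lmod R).

Lemma charD E (phi : charmod E) : {morph (sval phi : E -> QZ) : x y / x + y}.
Proof. exact: (svalP phi). Qed.

Lemma char_sumE E I (r : seq I) (P : pred I) (phi : I -> charmod E) (e : E) :
  sval (\sum_(i <- r | P i) phi i) e = \sum_(i <- r | P i) sval (phi i) e.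
Proof. exact: (addmorph_sum (phi := fun c : charmod E => sval c e)). Qed.

(* Over a finite index set, (E^n)^+ is (E^+)^n. *)
Definition char_coord E n (chi : ('I_n -> E) -> QZ)
    (chiD : {morph chi : x y / x + y}) (i : 'I_n) : charmod E :=
  exist (@zadd R E) (fun e => chi (single i e))
    (fun x y => etrans (congr1 chi (singleD i x y)) (chiD _ _)).

Lemma sum_char_coord E n (chi : ('I_n -> E) -> QZ)
    (chiD : {morph chi : x y / x + y}) (v : 'I_n -> E) :
  \sum_i sval (char_coord chiD i) (v i) = chi v.
Proof. by rewrite -[in RHS](sum_single v) (addmorph_sum chiD). Qed.

(** The system is solvable in a cofree module containing E. If E had no solution, a character [chi]
    of E^n killing all vectors (g_i x) but not [e] would have components phi_i with sum_i phi_i g_i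
    = 0. Then sum_i phi_i (x) e_i vanishes over the cofree module, hence over E by purity, and
    evaluation gives chi(e) = 0. *)
Lemma abs_pure_solve E n (g : 'I_n -> R) (e : 'I_n -> E) : abs_pure E ->
  (forall r : 'I_n -> R, \sum_i r i * g i = 0 -> \sum_i r i *: e i = 0) ->
  exists e0, forall i, e i = g i *: e0.
Proof.
move=> pureE compat.
pose N (v : 'I_n -> E) := exists e0, v = fun i => g i *: e0.
suff [e0 ->] : N e by exists e0.
apply: contrapT => nNe.
have [||chi [chiD chiN /eqP chie]] := @QZ_separates _ N e _ _ nNe.
- by exists 0; apply/funext => i; rewrite scaler0.
- move=> _ _ [x ->] [y ->]; exists (x - y); apply/funext => i.
  by rewrite scalerBr.
pose phi := char_coord chiD.
have phig0 : \sum_i rscale (phi i) (g i) = 0.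
  apply: char_eq => x; rewrite char_sumE.
  rewrite -[LHS]/(\sum_i sval (phi i) (g i *: x)) sum_char_coord.
  by apply: chiN; exists x.
have iotaP (x : E) (c : charmod E) :
    @zadd R^c (opp_lmod (reg_rmod R)) (fun r => sval c (r *: x)).
  by move=> r s; rewrite -charD; congr (sval c _); exact: scalerDl.
(* E embeds in the cofree module indexed by its own characters, since these separate points. *)
pose iota (x : E) : cofree R (charmod E) := fun c => exist _ _ (iotaP x c).
have iota_hom : lhom iota.
  split=> [x y|r x]; apply: functional_extensionality => c; apply: char_eq => s /=.
    by rewrite -charD; congr (sval c _); exact: scalerDr.
  by congr (sval c _); exact: scalerA.
have iota_inj : injective iota.
  move=> x y xy; apply: contrapT => neq.
  have [//|||c [cD _ /eqP[]]] := @QZ_separates _ (fun z : E => z = 0) (x - y).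
  - by move=> _ _ -> ->; rewrite subrr.
  - by move=> /eqP; rewrite subr_eq0 => /eqP.
  rewrite (addmorphB cD); apply/eqP; rewrite subr_eq0; apply/eqP.
  have := congr1 (fun w => sval (w (exist (@zadd R E) c cD)) 1) xy.
  by rewrite /= !scale1r.
have [w wP] : exists w : cofree R (charmod E), forall i, iota (e i) = g i *: w.
  have ext (c : charmod E) : exists psi : R -> QZ, {morph psi : x y / x + y} /\
      forall r i, psi (r * g i) = sval c (r *: e i).
    (* Coordinate [c] of the solution extends sum_i r_i g_i -> c(sum_i r_i e_i), which is
       single-valued by [compat]. *)
    pose G a q := exists r : 'I_n -> R,
      a = \sum_i r i * g i /\ q = sval c (\sum_i r i *: e i).
    have [||q|psi [psiD psiP]] := @QZ_ext R G.
    - exists (fun=> 0); rewrite !big1 ?(addmorph0 (charD c)) // => i _.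
        by rewrite scale0r.
      by rewrite mul0r.
    - move=> _ _ _ _ [r [-> ->]] [s [-> ->]]; exists (fun i => r i - s i).
      rewrite -(addmorphB (charD c)) -!sumrB; split; last congr (sval c _).
        by apply: eq_bigr => i _; rewrite mulrBl.
      by apply: eq_bigr => i _; rewrite scalerBl.
    - by move=> [r [/esym/compat -> ->]]; exact: (addmorph0 (charD c)).
    exists psi; split=> // r i; apply: psiP.
    exists (single i r); split; last congr (sval c _).
      rewrite (bigD1 i) //= /single eqxx big1 ?addr0 // => k /negPf->.
      by rewrite mul0r.
    rewrite (bigD1 i) //= /single eqxx big1 ?addr0 // => k /negPf->.
    by rewrite scale0r.
  have [psi psiP] := choice ext.
  exists (fun c => exist (@zadd R^c (opp_lmod (reg_rmod R))) (psi c) (proj1 (psiP c))).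
  move=> i; apply: functional_extensionality => c; apply: char_eq => r.
  exact: (esym (proj2 (psiP c) r i)).
pose s := [seq (phi i, e i) | i <- enum 'I_n].
have s0 : tensor_zero s.
  have [_ _ /(_ (charmod E)) pure_iota] := pureE _ iota iota_hom iota_inj.
  apply: pure_iota; apply/tensor_zeroP => b [bl br bs].
  rewrite big_map /s big_map big_enum /=.
  under eq_bigr => i _ do rewrite wP -bs.
  by rewrite -(addmorph_sum (bl w)) phig0 (addmorph0 (bl w)).
apply: chie; rewrite -(sum_char_coord chiD).
have := @balanced_tensor_zero _ _ _ (fun (c : charmod E) x => sval c x) s.
rewrite /s big_map big_enum /=; apply=> //; split=> // c; exact: charD.
Qed.

(** Coherence only provides some generators g' with finitely generated relations. With G' = A G, G =
    B G' and H G' = 0, any r with r G = 0 has r B = C H, so r = r(1 - B A) + C H A. *)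
Lemma coherent_fg_relations n (g : 'I_n -> R) : left_coherent R -> fg_relations g.
Proof.
move=> /(_ n g)[n' [g' [spanE [m [h hP]]]]].
have unit_span k (u : 'I_k -> R) i : lspan u (u i).
  exists (single i 1); rewrite (bigD1 i) //= /single eqxx mul1r big1 ?addr0 //.
  by move=> j /negPf->; rewrite mul0r.
have [a aP] := choice (fun k => (spanE (g' k)).2 (unit_span _ g' k)).
have [b bP] := choice (fun i => (spanE (g i)).1 (unit_span _ g i)).
pose A := \matrix_(k, i) a k i; pose B := \matrix_(i, k) b i k.
pose H := \matrix_(j, k) h j k.
pose G := \col_i g i; pose G' := \col_k g' k.
have G'E : G' = A *m G.
  by apply/matrixP => k z; rewrite !mxE aP; apply: eq_bigr => i _; rewrite !mxE.
have GE : G = B *m G'.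
  by apply/matrixP => k z; rewrite !mxE bP; apply: eq_bigr => i _; rewrite !mxE.
have relE k (u r : 'I_k -> R) :
    \sum_i r i * u i = 0 <-> (\row_i r i) *m (\col_i u i) = 0.
  split=> [ru|/matrixP/(_ 0 0)]; last first.
    by rewrite !mxE => ru; rewrite -[RHS]ru; apply: eq_bigr => i _; rewrite !mxE.
  by apply/matrixP => ? ?; rewrite !mxE -[RHS]ru; apply: eq_bigr => i _; rewrite !mxE.
have combE p k (u : 'M[R]_(p, k)) (r : 'I_k -> R) :
    (exists c, r = fun i => \sum_j c j * u j i) <-> exists C, \row_i r i = C *m u.
  split=> [[c ->]|[C rE]].
    by exists (\row_j c j); apply/rowP => i; rewrite !mxE; apply: eq_bigr => j _; rewrite !mxE.
  exists (C 0); apply: functional_extensionality => i.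
  by have /rowP/(_ i) := rE; rewrite !mxE.
have HG' : H *m G' = 0.
  apply/row_matrixP => j; rewrite row_mul row0.
  have /hP/relE : exists c, h j = fun i => \sum_j0 c j0 * h j0 i.
    exists (single j 1); apply: functional_extensionality => i.
    rewrite (bigD1 j) //= /single eqxx mul1r big1 ?addr0 // => k /negPf->.
    by rewrite mul0r.
  by congr (_ *m _ = _); apply/rowP => i; rewrite !mxE.
(* The first block compares [g] with its rewriting through [g']; the second expresses the relations
   of [g'] in [g]. *)
pose K := col_mx (1%:M - B *m A) (H *m A).
exists (n + m)%N, (fun j i => K j i) => r; rewrite relE combE -/G.
split=> [rG|[C ->]]; last first.
  rewrite -mulmxA mul_col_mx mulmxBl mul1mx -!mulmxA -G'E -GE subrr HG'.
  by rewrite col_mx0 mulmx0.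
have [C CE] : exists C, \row_i r i *m B = C *m H.
  have /hP[c cE] : \sum_k (\row_i r i *m B) 0 k * g' k = 0.
    apply/relE; rewrite -/G' (_ : \row__ _ = \row_i r i *m B).
      by rewrite -mulmxA -GE.
    by apply/rowP => k; rewrite mxE.
  exists (\row_j c j); apply/rowP => k; have := congr1 (@^~ k) cE => /= ->.
  by rewrite !mxE; apply: eq_bigr => j _; rewrite !mxE.
exists (row_mx (\row_i r i) C); rewrite mul_row_col mulmxBr mulmx1.
by rewrite !mulmxA -CE subrK.
Qed.

(** By [abs_pure_solve], every vector killed by [H] has the form (g_i e0), and [Phi] kills it
    because sum_i phi_i g_i = 0. So [Phi] factors through [H], and the components of the factor are
    the y_j. *)
Lemma coherent_flat_relations E :
  left_coherent R -> abs_pure E -> flat_relations (charmod E).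
Proof.
move=> cohR pureE n phi g phig0.
have [m [h hP]] := coherent_fg_relations g cohR.
have hg j : \sum_i h j i * g i = 0.
  apply/hP; exists (single j 1); apply: functional_extensionality => i.
  rewrite (bigD1 j) //= /single eqxx mul1r big1 ?addr0 // => k /negPf->.
  by rewrite mul0r.
pose Phi (v : 'I_n -> E) := \sum_i sval (phi i) (v i).
pose H (v : 'I_n -> E) : 'I_m -> E := fun j => \sum_i h j i *: v i.
have PhiD : {morph Phi : v w / v + w}.
  by move=> v w; rewrite -big_split; apply: eq_bigr => i _; exact: charD.
have HD : {morph H : v w / v + w}.
  move=> v w; apply: functional_extensionality => j; rewrite -[RHS]/(_ + _) -big_split.
  by apply: eq_bigr => i _; exact: scalerDr.
have [||q|psi [psiD psiP]] := @QZ_ext _ (fun w q => exists v, w = H v /\ q = Phi v).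
- by exists 0; rewrite (addmorph0 HD) (addmorph0 PhiD).
- move=> _ _ _ _ [v [-> ->]] [w [-> ->]]; exists (v - w).
  by rewrite (addmorphB HD) (addmorphB PhiD).
- move=> [v [/esym Hv0 ->]]; have [|e0 vE] := @abs_pure_solve E n g v pureE.
    (* Relations of [g] are combinations of the rows of [h], so [H v = 0] yields compatibility. *)
    move=> r /hP[c ->].
    under eq_bigr => i _ do rewrite scaler_suml.
    rewrite exchange_big big1 // => j _; under eq_bigr => i _ do rewrite -scalerA.
    by rewrite -scaler_sumr -[X in _ *: X]/(H v j) Hv0 scaler0.
  rewrite /Phi; under eq_bigr => i _ do rewrite vE.
  by have := congr1 (fun c => sval c e0) phig0; rewrite char_sumE.
exists m, (char_coord psiD), h; split=> // i; apply: char_eq => e.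
rewrite char_sumE -[RHS]/(\sum_j sval (char_coord psiD j) (h j i *: e)).
rewrite sum_char_coord; symmetry; apply: psiP; exists (single i e); split.
  apply: functional_extensionality => j.
  rewrite /H (bigD1 i) //= /single eqxx big1 ?addr0 // => k /negPf->.
  by rewrite scaler0.
rewrite /Phi (bigD1 i) //= /single eqxx big1 ?addr0 // => k /negPf->.
exact: (addmorph0 (charD _)).
Qed.

Lemma flat_dual_precover A E (f : A -> E) (hf : lhom f) :
  injective f -> flat (charmod E) -> precover (@flat R) (dualmap hf).
Proof.
move=> finj flatE; split=> // [|F u flatF [uD uS]].
  by split=> *; apply: char_eq => a //=; rewrite (proj2 hf).
have {}uD : {morph u : x y / x + y} := uD.
have bu : balanced (fun x a => sval (u x) a).
  split=> [a x y|x|x r a]; [by rewrite uD|exact: charD|by rewrite uS].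
pose push (s : seq (F * A)) := [seq (p.1, f p.2) | p <- s].
pose neg (s : seq (F * A)) := [seq (- p.1, p.2) | p <- s].
pose val s := \sum_(p <- s) sval (u p.1) p.2.
have valB s t : val (s ++ neg t) = val s - val t.
  rewrite /val big_cat big_map -sumrN; congr (_ + _); apply: eq_bigr => p _.
  by rewrite /= (addmorphN uD).
(* Modulo relations, a sum of x (x) f(a) is assigned the sum of u(x)(a). *)
pose G (v : F -> E -> int) q := exists s, tensor_rel (v - fsum_of (push s)) /\ q = val s.
have Grel g : tensor_rel g -> G g 0.
  move=> rg; exists [::]; rewrite /val big_nil; split=> //.
  by rewrite fsum_ofE big_nil subr0.
have [||q|psi [psiD psiP]] := @QZ_ext _ G.
- exact/Grel/trel0.
- move=> v w _ _ [s [rs ->]] [t [rt ->]]; exists (s ++ neg t); split=> //.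
  have := tensor_relB (tensor_relB rs rt) (tensor_rel_neg (push t)).
  have -> : [seq (- p.1, p.2) | p <- push t] = push (neg t) by rewrite /push /neg -!map_comp.
  congr tensor_rel; rewrite /push map_cat -/(push _) -/(push _) !fsum_ofE big_cat /=.
  move: (\sum_(_ <- push s) _) (\sum_(_ <- push t) _) (\sum_(_ <- push (neg t)) _) => a b c.
  by rewrite !opprD opprK !addrA [_ - c - b]addrAC addrK (addrAC v).
(* Single-valuedness is where flatness of F enters, through injectivity of 1 (x) f. *)
- move=> [s [rs ->]]; apply: (balanced_tensor_zero bu).
  apply: (flatF A E f hf finj); rewrite sub0r in rs.
  by have := trelopp rs; congr tensor_rel; exact: opprK.
have psi0 g : tensor_rel g -> psi g = 0 by move=> /Grel/psiP.
have [bl br bs] := balanced_of_character psiD psi0.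
exists (fun x => exist (@zadd R E) (fun e => psi (delta x e)) (br x)); split.
  split=> [x y|x r]; apply: char_eq => e; [exact: bl | exact: bs].
move=> x; apply: char_eq => a /=; apply: psiP; exists [:: (x, a)]; split.
  by rewrite fsum_ofE big_seq1 subrr; exact: trel0.
by rewrite /val big_seq1.
Qed.

(** Analogue of [single] for an arbitrary index type, with equality decided classically. *)
Definition atom (T : Type) (D : lmod R) (c : T) (d : D) : prod_lmod T D :=
  fun t => if pselect (t = c) then d else 0.

Lemma atomD T D (c : T) : {morph (@atom T D c) : x y / x + y}.
Proof.
move=> x y; apply: functional_extensionality => t; rewrite -[RHS]/(atom c x t + atom c y t) /atom.
by case: pselect => _ /=; rewrite ?addr0.
Qed.

Lemma atomZ T D (c : T) r : {morph (@atom T D c) : x / r *: x}.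
Proof.
move=> x; apply: functional_extensionality => t; rewrite -[RHS]/(r *: atom c x t) /atom.
by case: pselect => _ /=; rewrite ?scaler0.
Qed.

(* The module W = cofree ('I_n -> R) carries characters phi_i that restrict to
   evaluation at c_i on the factor indexed by each relation c of g, and satisfy
   sum_i phi_i g_i = 0.  Expanding the phi_i along finitely many relations
   forces those relations to generate all of them. *)
Lemma flat_relations_fg_relations n (g : 'I_n -> R) :
  flat_relations (charmod (cofree R ('I_n -> R))) -> fg_relations g.
Proof.
set T := 'I_n -> R; set D := rdual (reg_rmod R); set W := cofree R T => relW.
have dD (d : D) : {morph (sval d : R -> QZ) : x y / x + y} := svalP d.
have projD t : {morph (fun w : W => w t) : x y / x + y} by [].
have evalD r : {morph (fun d : D => sval d r) : x y / x + y} by [].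
pose K : set T := fun c => \sum_i c i * g i = 0.
pose fin (s : seq (T * ('I_n -> D))) : 'I_n -> W :=
  fun i => \sum_(p <- s) atom p.1 (p.2 i).
pose ev (p : T * ('I_n -> D)) := \sum_i sval (p.2 i) (p.1 i).
(* The partial character evaluates at c on the factor of each relation c. Its vanishing on the
   vectors (g_i e) forces sum_i phi_i g_i = 0. *)
pose G (w : 'I_n -> W) q := exists s (e : W), [/\ forall p, p \in s -> K p.1,
  w = (fun i => fin s i + g i *: e) & q = \sum_(p <- s) ev p].
have [||q|Phi [PhiD PhiP]] := @QZ_ext _ G.
- exists [::], 0; rewrite big_nil; split=> //; apply: functional_extensionality => i.
  by rewrite /fin big_nil scaler0 addr0.
- move=> _ _ _ _ [s [e [Ks -> ->]]] [s' [e' [Ks' -> ->]]].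
  exists (s ++ [seq (p.1, fun i => - p.2 i) | p <- s']), (e - e'); split.
  + by move=> p; rewrite mem_cat => /orP[/Ks //|/mapP[p' /Ks' Kp' ->]].
  + apply: functional_extensionality => i.
    have negE : \sum_(p <- s') (atom p.1 (- p.2 i) : W) = - fin s' i.
      by rewrite -sumrN; apply: eq_bigr => p _; exact: (addmorphN (atomD _)).
    rewrite -[LHS]/(_ - _) [fin (_ ++ _) i]big_cat big_map /= negE scalerBr.
    by rewrite opprD addrACA.
  + rewrite big_cat big_map /= -sumrN; congr (_ + _); apply: eq_bigr => p _.
    by rewrite /ev -sumrN.
(* In the factor of a relation t the entries of index i add up to - g_i e_t, so their evaluations
   give - e_t(sum_i t_i g_i) = 0. *)
- move=> [s [e [Ks w0 ->]]]; apply: (@sum_fibers_eq0 _ _ _ fst) => t.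
  have [Kt|nKt] := pselect (K t); last first.
    rewrite big_seq_cond big1 // => p /andP[/Ks Kp /eqP pt].
    by case: nKt; rewrite -pt.
  have fiber i : \sum_(p <- s | p.1 == t) p.2 i = - (g i *: e t).
    apply/eqP; rewrite -addr_eq0; apply/eqP.
    have w0it : fin s i t + g i *: e t = 0 :> D :=
      esym (congr1 (fun w : 'I_n -> W => w i t) w0).
    rewrite -[RHS]w0it /fin (addmorph_sum (projD t)).
    congr (_ + _); rewrite big_mkcond; apply: eq_bigr => p _.
    rewrite /atom; case: pselect => tp /=; first by rewrite -tp eqxx.
    by case: eqP => // pt; case: tp.
  rewrite (eq_bigr (fun p => \sum_i sval (p.2 i) (t i))); last by move=> p /eqP <-.
  rewrite exchange_big /=.
  under eq_bigr => i _ do rewrite -(addmorph_sum (evalD (t i))) fiber.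
  transitivity (- sval (e t) (\sum_i t i * g i)).
    by rewrite (addmorph_sum (dD _)) -sumrN.
  by rewrite Kt (addmorph0 (dD _)) oppr0.
pose phi := char_coord PhiD.
have phig0 : \sum_i rscale (phi i) (g i) = 0.
  apply: char_eq => e; rewrite char_sumE.
  rewrite -[LHS]/(\sum_i sval (phi i) (g i *: e)) sum_char_coord.
  apply: PhiP; exists [::], e; split=> //; last by rewrite big_nil.
  by apply: functional_extensionality => i; rewrite /fin big_nil add0r.
have [m [y [h [phiE hg]]]] := relW _ phi g phig0.
exists m, h => c; split=> [Kc|[a ->]]; last first.
  under eq_bigr => i _ do rewrite mulr_suml.
  rewrite exchange_big big1 // => j _; under eq_bigr => i _ do rewrite -mulrA.
  by rewrite -mulr_sumr hg mulr0.
apply: contrapT => nLc.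
(* A relation [c] outside the row span of [h] is detected by a character [chi] vanishing on that
   span; its components d_i in R^+ satisfy sum_i h_ji d_i = 0. *)
have [||chi [chiD chi0 /eqP[]]] := @QZ_separates T
  (fun r => exists a : 'I_m -> R, r = fun i => \sum_j a j * h j i) c _ _ nLc.
- exists (fun=> 0); apply: functional_extensionality => i.
  by rewrite big1 // => j _; rewrite mul0r.
- move=> _ _ [a ->] [b ->]; exists (fun j => a j - b j).
  apply: functional_extensionality => i; rewrite -[LHS]/(_ - _) -sumrB.
  by apply: eq_bigr => j _; rewrite mulrBl.
have dP i : @zadd R^c (opp_lmod (reg_rmod R)) (fun r => chi (single i r)).
  by move=> r s; rewrite -chiD -singleD.
pose d i : D := exist _ _ (dP i).
have hd0 j : \sum_i h j i *: d i = 0.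
  apply: char_eq => r; rewrite (addmorph_sum (evalD r)) /=.
  rewrite -(addmorph_sum chiD) (sum_single (fun i => r * h j i)).
  apply: chi0; exists (single j r); apply: functional_extensionality => i.
  rewrite (bigD1 j) //= /single eqxx big1 ?addr0 // => k /negPf->.
  by rewrite mul0r.
(* [Phi] takes the value chi(c) on the d_i placed in factor c, while expanding phi_i through the y_j
   gives 0. *)
transitivity (Phi (fun i => atom c (d i))).
  symmetry; apply: PhiP; exists [:: (c, d)], 0; split.
  - by move=> p; rewrite inE => /eqP->.
  - by apply: functional_extensionality => i; rewrite /fin big_seq1 scaler0 addr0.
  - by rewrite big_seq1 /ev /= -(addmorph_sum chiD) sum_single.
rewrite -(sum_char_coord PhiD) -/phi.
under eq_bigr => i _ do rewrite phiE char_sumE.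
rewrite exchange_big big1 // => j _.
transitivity (\sum_i sval (y j) (h j i *: (atom c (d i) : W))); first by [].
rewrite -(addmorph_sum (charD (y j))).
under eq_bigr => i _ do rewrite -atomZ.
by rewrite -(addmorph_sum (atomD c)) hd0 (addmorph0 (atomD c)) (addmorph0 (charD _)).
Qed.

End Coherence.

Theorem theorem3p5 (R : nzRingType) :
  (left_coherent R <->
     (forall (A E : lmod R) (f : A -> E) (hf : lhom f),
        injective f -> preenvelope (@abs_pure R) f ->
        precover (@flat R) (dualmap hf)))
  /\
  (left_coherent R ->
     (forall (A E : lmod R) (f : A -> E) (hf : lhom f),
        injective f -> preenvelope (@injective_mod R) f ->
        precover (@flat R) (dualmap hf))).
Proof.
have pre (A E : lmod R) (f : A -> E) (hf : lhom f) : left_coherent R -> injective f ->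
    abs_pure E -> precover (@flat R) (dualmap hf).
  move=> cohR finj pureE; apply: flat_dual_precover => //.
  exact/flat_relations_flat/coherent_flat_relations.
split; [split=> [cohR A E f hf finj [_ pureE _]|dual]|].
- exact: pre.
(* The given generators are kept, and flatness of the dual is read off from the precover property
   for the identity of [W]. *)
- move=> n g; exists n, g; split=> //; apply: flat_relations_fg_relations.
  apply: flat_flat_relations; set W := cofree R _.
  have id_hom : lhom (id : W -> W) by [].
  have [] // := dual W W id id_hom; split=> //.
    exact/injective_abs_pure/cofree_injective.
  by move=> E' u _ hu; exists u.
- move=> cohR A E f hf finj [_ injE _]; apply: pre => //.
  exact: injective_abs_pure.
Qed.
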